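(* Let $\mathcal{H}$ be a separable right quaternionic Hilbert space and let $T,R\in\mathcal{B}(\mathcal{H})$ be approximately unitarily equivalent. Then (i) $\sigma_S(T)=\sigma_S(R)$; (ii) $\overline{W(T)}=\overline{W(R)}$.
   Context: $\mathbb{H}$ denotes the real quaternions. $\mathcal{H}$ is a right quaternionic Hilbert space with inner product $\langle\cdot,\cdot\rangle$ that is right $\mathbb{H}$-linear in the first variable, satisfies $\langle x,y\rangle=\langle y,x\rangle^*$ and is positive definite; $\mathcal{H}$ is separable, with a countable orthonormal basis $\{e_n:n\in\mathbb{N}\}$. $\mathcal{B}(\mathcal{H})$ is the set of bounded right $\mathbb{H}$-linear operators on $\mathcal{H}$ with the operator norm, and $\mathcal{U}(\mathcal{H})$ is the group of unitary operators ($U^*U=UU^*=I$). $T$ and $R$ are approximately unitarily equivalent, written $T\sim_a R$, if there is a sequence $(U_n)_n\subset\mathcal{U}(\mathcal{H})$ with $\lim_{n\to\infty}\|U_nRU_n^*-T\|=0$. For $q\in\mathbb{H}$ put $\Delta_q(T)=T^2-2\,\mathrm{Re}(q)\,T+|q|^2 I$; the S-spectrum is $\sigma_S(T)=\{q\in\mathbb{H}:\Delta_q(T)\text{ is not invertible in }\mathcal{B}(\mathcal{H})\}$. The quaternionic numerical range is $W(T)=\{\langle Tx,x\rangle: x\in\mathcal{H},\ \|x\|=1\}\subset\mathbb{H}$. *)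

(* Defs.v *)
From HB Require Import structures.
From mathcomp Require Import all_boot all_order all_algebra.
From mathcomp Require Import ring lra.
From mathcomp Require Import all_classical all_reals all_analysis.
Set Implicit Arguments.
Unset Strict Implicit.
Unset Printing Implicit Defensive.
Import Order.TTheory GRing.Theory Num.Theory.
Import numFieldNormedType.Exports.
Local Open Scope classical_set_scope.
Local Open Scope ring_scope.

Record quat (R : Type) : Type :=
  Quat { qre : R; qi : R; qj : R; qk : R }.

Section QuatRing.
Variable R : realType.
Implicit Types p q r : quat R.

Definition quat_tuple q := (qre q, qi q, qj q, qk q).
Definition tuple_quat (t : R * R * R * R) : quat R :=
  let: (a, b, c, d) := t in Quat a b c d.

Lemma quat_tupleK : cancel quat_tuple tuple_quat.
Proof. by case. Qed.

HB.instance Definition _ := Choice.copy (quat R) (can_type quat_tupleK).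

Lemma quatP p q :
  qre p = qre q -> qi p = qi q -> qj p = qj q -> qk p = qk q -> p = q.
Proof. by case: p => a b c d; case: q => a' b' c' d' /= -> -> -> ->. Qed.

Definition qzero : quat R := Quat 0 0 0 0.
Definition qadd p q : quat R :=
  Quat (qre p + qre q) (qi p + qi q) (qj p + qj q) (qk p + qk q).
Definition qopp p : quat R := Quat (- qre p) (- qi p) (- qj p) (- qk p).

Lemma qaddA : associative qadd.
Proof. by move=> p q r; apply: quatP; exact: addrA. Qed.
Lemma qaddC : commutative qadd.
Proof. by move=> p q; apply: quatP; exact: addrC. Qed.
Lemma qadd0 : left_id qzero qadd.
Proof. by move=> p; apply: quatP; exact: add0r. Qed.
Lemma qaddN : left_inverse qzero qopp qadd.
Proof. by move=> p; apply: quatP; exact: addNr. Qed.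

HB.instance Definition _ :=
  GRing.isZmodule.Build (quat R) qaddA qaddC qadd0 qaddN.

Definition qone : quat R := Quat 1 0 0 0.
Definition qmul p q : quat R :=
  Quat (qre p * qre q - qi p * qi q - qj p * qj q - qk p * qk q)
       (qre p * qi q + qi p * qre q + qj p * qk q - qk p * qj q)
       (qre p * qj q - qi p * qk q + qj p * qre q + qk p * qi q)
       (qre p * qk q + qi p * qj q - qj p * qi q + qk p * qre q).

Lemma qmulA : associative qmul.
Proof. by move=> p q r; apply: quatP => /=; ring. Qed.
Lemma qmul1l : left_id qone qmul.
Proof. by move=> p; apply: quatP => /=; ring. Qed.
Lemma qmul1r : right_id qone qmul.
Proof. by move=> p; apply: quatP => /=; ring. Qed.
Lemma qmulDl : left_distributive qmul +%R.
Proof. by move=> p q r; apply: quatP => /=; ring. Qed.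
Lemma qmulDr : right_distributive qmul +%R.
Proof. by move=> p q r; apply: quatP => /=; ring. Qed.
Lemma qone_neq0 : qone != 0.
Proof. by apply/eqP => -[/eqP]; rewrite oner_eq0. Qed.

HB.instance Definition _ := GRing.Zmodule_isNzRing.Build (quat R)
  qmulA qmul1l qmul1r qmulDl qmulDr qone_neq0.

Definition qscale (a : R) q : quat R :=
  Quat (a * qre q) (a * qi q) (a * qj q) (a * qk q).

Lemma qscaleA a b q : qscale a (qscale b q) = qscale (a * b) q.
Proof. by apply: quatP; exact: mulrA. Qed.
Lemma qscale1 : left_id 1 qscale.
Proof. by move=> q; apply: quatP; exact: mul1r. Qed.
Lemma qscaleDr : right_distributive qscale +%R.
Proof. by move=> a p q; apply: quatP; exact: mulrDr. Qed.
Lemma qscaleDl q : {morph qscale^~ q : a b / a + b}.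
Proof. by move=> a b; apply: quatP; exact: mulrDl. Qed.

HB.instance Definition _ := GRing.Zmodule_isLmodule.Build R (quat R)
  qscaleA qscale1 qscaleDr qscaleDl.

Lemma qscaleAl (a : R) p q : a *: (p * q) = (a *: p) * q.
Proof. by apply: quatP => /=; ring. Qed.
HB.instance Definition _ := GRing.Lmodule_isLalgebra.Build R (quat R) qscaleAl.
Lemma qscaleAr (a : R) p q : a *: (p * q) = p * (a *: q).
Proof. by apply: quatP => /=; ring. Qed.
HB.instance Definition _ := GRing.Lalgebra_isAlgebra.Build R (quat R) qscaleAr.

Definition qconj q : quat R := Quat (qre q) (- qi q) (- qj q) (- qk q).

Definition qnorm q : R :=
  Num.sqrt (qre q ^+ 2 + qi q ^+ 2 + qj q ^+ 2 + qk q ^+ 2).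

Lemma qsum_ge0 q : 0 <= qre q ^+ 2 + qi q ^+ 2 + qj q ^+ 2 + qk q ^+ 2.
Proof. by rewrite !addr_ge0 ?sqr_ge0. Qed.

Lemma qnormD p q : qnorm (p + q) <= qnorm p + qnorm q.
Proof.
rewrite -ler_sqr ?nnegrE ?addr_ge0 ?sqrtr_ge0// sqrrD !sqr_sqrtr ?qsum_ge0//.
set s := qre p * qre q + qi p * qi q + qj p * qj q + qk p * qk q.
have sle : s <= qnorm p * qnorm q.
  apply: le_trans (ler_norm _) _.
  rewrite -ler_sqr ?nnegrE ?mulr_ge0 ?sqrtr_ge0// exprMn !sqr_sqrtr ?qsum_ge0//.
  rewrite real_normK ?num_real// -subr_ge0 /s.
  rewrite (_ : _ - _ =
      (qre p * qi q - qi p * qre q) ^+ 2 + (qre p * qj q - qj p * qre q) ^+ 2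
    + (qre p * qk q - qk p * qre q) ^+ 2 + (qi p * qj q - qj p * qi q) ^+ 2
    + (qi p * qk q - qk p * qi q) ^+ 2 + (qj p * qk q - qk p * qj q) ^+ 2).
    by rewrite !addr_ge0 ?sqr_ge0.
  by ring.
rewrite (_ : _ + _ = qre p ^+ 2 + qi p ^+ 2 + qj p ^+ 2 + qk p ^+ 2 + s *+ 2
    + (qre q ^+ 2 + qi q ^+ 2 + qj q ^+ 2 + qk q ^+ 2)); last by rewrite /s /=; ring.
by rewrite lerD2r lerD2l lerMn2r.
Qed.

Lemma qnormZ (a : R) q : qnorm (a *: q) = `|a| * qnorm q.
Proof.
rewrite -sqrtr_sqr -sqrtrM ?sqr_ge0//; congr Num.sqrt => /=; ring.
Qed.

Lemma qnorm0_eq0 q : qnorm q = 0 -> q = 0.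
Proof.
move/eqP; rewrite sqrtr_eq0 => h.
have /eqP := le_anti (introT andP (conj h (qsum_ge0 q))).
rewrite !paddr_eq0 ?addr_ge0 ?sqr_ge0// !sqrf_eq0.
by move=> /andP[/andP[/andP[/eqP? /eqP?] /eqP?] /eqP?]; apply: quatP.
Qed.

HB.instance Definition _ := isPointed.Build (quat R) 0.
HB.instance Definition _ :=
  Lmodule_isNormed.Build R (quat R) qnormD qnormZ qnorm0_eq0.

End QuatRing.

(* The Hilbert norm is the norm of the underlying real Banach space: [qdot_norm]
   ties it to the inner product, and [rscale_real] identifies the real scaling
   with right multiplication by real quaternions. *)
HB.mixin Record isQuatHilbert (R : realType) H & NormedModule R H := {
  rscale : H -> quat R -> H ;
  rscaleDl : forall x y q, rscale (x + y) q = rscale x q + rscale y q ;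
  rscaleDr : forall x p q, rscale x (p + q) = rscale x p + rscale x q ;
  rscaleM : forall x p q, rscale x (p * q) = rscale (rscale x p) q ;
  rscale1 : forall x, rscale x 1 = x ;
  rscale_real : forall x (a : R), rscale x a%:A = a *: x ;
  qdot : H -> H -> quat R ;
  qdotDl : forall x y z, qdot (x + y) z = qdot x z + qdot y z ;
  qdotZl : forall x y q, qdot (rscale x q) y = qdot x y * q ;
  qdotC : forall x y, qdot x y = qconj (qdot y x) ;
  qdot_ge0 : forall x, 0 <= qre (qdot x x) ;
  qdot_eq0 : forall x, qdot x x = 0 -> x = 0 ;
  qdot_norm : forall x, `|x| = Num.sqrt (qre (qdot x x))
}.

#[short(type="quatHilbertType")]
HB.structure Definition QuatHilbert (R : realType) :=
  {H of isQuatHilbert R H & CompleteNormedModule R H}.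

Definition separable (T : topologicalType) : Prop :=
  exists D : set T, countable D /\ dense D.

Section Operators.
Variables (R : realType) (H : quatHilbertType R).
Implicit Types S T U V : H -> H.

Definition right_linear T : Prop :=
  (forall x y, T (x + y) = T x + T y) /\
  (forall x (q : quat R), T (rscale x q) = rscale (T x) q).

Definition bounded_op : set (H -> H) :=
  [set T | right_linear T /\ exists M : R, forall x, `|T x| <= M * `|x|].

Definition opnorm T : R := sup [set `|T x| | x in [set x : H | `|x| <= 1]].

Definition invertible_op T : Prop :=
  exists S, [/\ bounded_op S, S \o T = id & T \o S = id].

Definition is_adjoint T S : Prop :=
  bounded_op S /\ forall x y, qdot (T x) y = qdot x (S y).

(* [unitary_op U V]: U is unitary and V is U^*. The adjoint of a bounded
   operator is unique, so naming it here avoids choosing an adjoint operation. *)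
Definition unitary_op U V : Prop :=
  [/\ bounded_op U, is_adjoint U V, V \o U = id & U \o V = id].

Definition approx_unitary_equiv T S : Prop :=
  exists U V : nat -> H -> H,
    (forall n, unitary_op (U n) (V n)) /\
    opnorm (U n \o S \o V n \- T) @[n --> \oo] --> 0.

Definition Delta (q : quat R) T : H -> H :=
  fun x => T (T x) - (2 * qre q) *: T x + (`|q| ^+ 2) *: x.

Definition S_spectrum T : set (quat R) :=
  [set q | ~ invertible_op (Delta q T)].

Definition numerical_range T : set (quat R) :=
  [set qdot (T x) x | x in [set x : H | `|x| = 1]].

End Operators.

(* Main.v *)
(* Approximate unitary equivalence is symmetric, so it suffices to show one
   inclusion in each part. A conjugate [U S U^*] has the same S-spectrum and
   numerical range as [S] and its [Delta q] has an inverse of the same norm; as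
   this norm does not depend on [U], [Delta q T] is a small perturbation of an
   invertible operator once [U S U^*] is close enough to [T]. *)
Require Import Defs.
From mathcomp Require Import all_boot all_order all_algebra.
From mathcomp Require Import ring lra.
From mathcomp Require Import all_classical all_reals all_analysis.

Import Order.TTheory GRing.Theory Num.Theory.
Import numFieldNormedType.Exports.

Local Open Scope classical_set_scope.

Section QuatHilbertTheory.
Local Open Scope ring_scope.
Context {R : realType} {H : quatHilbertType R}.
Implicit Types (x y z : H) (T S U V A B D : H -> H).

(** * The quaternionic inner product and its norm *)

Lemma quat_normE (q : quat R) : `|q| = qnorm q.
Proof. by []. Qed.

Lemma qre_self_conj_mul (q : quat R) : qre (qconj q * q) = `|q| ^+ 2.
Proof. rewrite quat_normE /qnorm sqr_sqrtr ?qsum_ge0//=; ring. Qed.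

Lemma qdotZr x y (q : quat R) : qdot x (rscale y q) = qconj q * qdot x y.
Proof.
rewrite qdotC qdotZl [qdot x y]qdotC.
by case: (qdot y x) q => a b c d [a' b' c' d']; apply: quatP => /=; ring.
Qed.

Lemma qdotDr x y z : qdot x (y + z) = qdot x y + qdot x z.
Proof.
rewrite qdotC qdotDl [qdot x y]qdotC [qdot x z]qdotC.
by apply: quatP => //=; rewrite opprD.
Qed.

Lemma normr2_qdot x : `|x| ^+ 2 = qre (qdot x x).
Proof. by rewrite qdot_norm sqr_sqrtr ?qdot_ge0. Qed.

Lemma qdotNl x y : qdot (- x) y = - qdot x y.
Proof.
have d0 : qdot 0 y = 0.
  by apply: (addrI (qdot 0 y)); rewrite -qdotDl !addr0.
by apply/eqP; rewrite -addr_eq0 -qdotDl addNr d0.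
Qed.

(** Hermitian symmetry makes each imaginary part equal to its own negative, hence zero. *)
Lemma qdot_selfE x : qdot x x = (`|x| ^+ 2)%:A.
Proof.
rewrite normr2_qdot; have := qdotC x x.
by case: (qdot x x) => a b c d [] ? ? ?; apply: quatP => /=; lra.
Qed.

(* [0 <= |x - y <x,y>|^2 = |x|^2 - |<x,y>|^2] *)
Lemma qdot_le_norm x y : `|y| = 1 -> `|qdot x y| <= `|x|.
Proof.
move=> y1; rewrite -ler_sqr ?nnegrE// -subr_ge0.
set q := qdot x y.
have yy : qdot y y = 1 by rewrite qdot_selfE y1 expr1n scale1r.
have yx : qdot y x = qconj q by rewrite qdotC.
have := qdot_ge0 (x + rscale y (- q)).
rewrite qdotDl !qdotDr !qdotZr !qdotZl yy yx -/q mul1r.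
rewrite qdot_selfE -(qre_self_conj_mul q).
set n := `|x| ^+ 2; case: (q) => a b c d /=; lra.
Qed.

(** * Right linear and bounded operators *)

Section RightLinear.
Variables (T : H -> H) (Tlin : right_linear T).

Lemma right_linearZ (a : R) x : T (a *: x) = a *: T x.
Proof. by rewrite -!rscale_real (proj2 Tlin). Qed.

Lemma right_linearN x : T (- x) = - T x.
Proof. by rewrite -scaleN1r right_linearZ scaleN1r. Qed.

Lemma right_linearB x y : T (x - y) = T x - T y.
Proof. by rewrite (proj1 Tlin) right_linearN. Qed.

End RightLinear.

Lemma rscale_scale (a : R) x (q : quat R) :
  rscale (a *: x) q = a *: rscale x q.
Proof.
rewrite -!rscale_real -!rscaleM; congr rscale.
by rewrite -scalerAl mul1r -scalerAr mulr1.
Qed.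

Lemma rscaleBl x y (q : quat R) : rscale (x - y) q = rscale x q - rscale y q.
Proof. by rewrite rscaleDl -scaleN1r rscale_scale scaleN1r. Qed.

Lemma right_linear_comp T S :
  right_linear T -> right_linear S -> right_linear (T \o S).
Proof.
by move=> [Ta Tr] [Sa Sr]; split=> [x y|x q] /=; rewrite ?Sa ?Ta ?Sr ?Tr.
Qed.

Lemma right_linear_Delta (q : quat R) T :
  right_linear T -> right_linear (Delta q T).
Proof.
move=> [Ta Tr]; split=> [x y|x p]; rewrite /Delta.
  by rewrite !Ta !scalerDr opprD [X in X + _ = _]addrACA [LHS]addrACA.
by rewrite !Tr rscaleDl rscaleBl !rscale_scale.
Qed.

(** Strict positivity lets constants built from the bound be inverted. *)
Lemma bounded_op_norm T : bounded_op T ->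
  exists2 M : R, 0 < M & forall x, `|T x| <= M * `|x|.
Proof.
move=> [_ [M TM]]; exists (`|M| + 1); first by rewrite ltr_wpDl.
move=> x; apply: le_trans (TM x) _; apply: ler_wpM2r => //.
by apply: le_trans (ler_norm _) _; rewrite lerDl.
Qed.

(** Rescaling [x] to norm 1 lands in the set whose supremum is [opnorm T]; boundedness of [T] makes
    this supremum a genuine upper bound. *)
Lemma le_opnorm T x : bounded_op T -> `|T x| <= opnorm T * `|x|.
Proof.
move=> Tb; have [M M0 TM] := bounded_op_norm T Tb.
have Tl := proj1 Tb.
have [->|x0] := eqVneq x 0.
  by rewrite -(subrr 0) (right_linearB _ Tl) !subrr !normr0 mulr0.
have nx0 : 0 < `|x| by rewrite normr_gt0.
rewrite -ler_pdivrMr// mulrC -[`|x|^-1]ger0_norm ?invr_ge0// -normrZ.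
rewrite -(right_linearZ _ Tl); apply: ub_le_sup.
  exists M => _ [z /= z1 <-]; apply: le_trans (TM z) _.
  by rewrite ler_piMr// ltW.
by exists (`|x|^-1 *: x) => //=; rewrite normrZ normfV normr_id mulVf ?gt_eqF.
Qed.

(** * Unitary operators and approximation up to unitaries *)

Lemma unitary_op_isometry U V x : unitary_op U V -> `|V x| = `|x|.
Proof.
move=> [_ [_ UV] _ /funeqP UVK].
(* [<V x, V x> = <U (V x), x> = <x, x>]. *)
by rewrite !qdot_norm -UV -[U (V x)]/((U \o V) x) UVK.
Qed.

Lemma unitary_op_sym U V : unitary_op U V -> unitary_op V U.
Proof.
move=> [Ub [Vb UV] VUK UVK]; split=> //; split=> // x y.
by rewrite qdotC -UV -qdotC.
Qed.

(** A pointwise form of approximate unitary equivalence: with neither a sequence nor a supremum, it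
    is easy to reverse and to apply to vectors. *)
Definition unitarily_close T S : Prop := forall e : R, 0 < e ->
  exists U V, unitary_op U V /\ forall x, `|U (S (V x)) - T x| <= e * `|x|.

Lemma approx_unitary_equiv_close T S : bounded_op T -> bounded_op S ->
  approx_unitary_equiv T S -> unitarily_close T S.
Proof.
move=> bT bS [U [V [UV /cvgrPdist_lt cv]]] e e0.
have [n _ /(_ n (leqnn n))] := cv e e0.
rewrite sub0r normrN => /= lt_e; exists (U n), (V n); split=> // x.
have [[Ul _] [[Vl _] _] _ _] := UV n.
(* [le_opnorm] turns convergence of operator norms into pointwise estimates, but only for a bounded
   operator. *)
have bW : bounded_op (U n \o S \o V n \- T).
  have [[Tl _] [Sl _]] := (bT, bS).
  have [Wa Wr] := right_linear_comp _ _ (right_linear_comp _ _ Ul Sl) Vl.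
  split; first split=> [y z|y q] /=.
  - by rewrite [U n _]Wa (proj1 Tl) opprD addrACA.
  - by rewrite [U n _]Wr (proj2 Tl) rscaleBl.
  have [M M0 TM] := bounded_op_norm T bT.
  have [K K0 SK] := bounded_op_norm S bS.
  exists (K + M) => y /=; apply: le_trans (ler_normB _ _) _.
  rewrite mulrDl lerD//.
  rewrite (unitary_op_isometry _ _ _ (unitary_op_sym _ _ (UV n))).
  by rewrite -(unitary_op_isometry _ _ y (UV n)).
apply: le_trans (le_opnorm _ x bW) _; apply: ler_wpM2r => //.
by apply: le_trans (ler_norm _) (ltW _).
Qed.

(** Evaluate the estimate at [U x] and apply the isometry [V] to the difference: it becomes
    [V (T (U x)) - S x], with the same norm. *)
Lemma unitarily_close_sym T S : unitarily_close T S -> unitarily_close S T.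
Proof.
move=> TS e /TS[U [V [UV UVe]]]; exists V, U.
have VU := unitary_op_sym _ _ UV; split=> // x.
have [[Ul _] [[Vl _] _] /funeqP VUK _] := UV.
have := UVe (U x); rewrite -[V (U x)]/((V \o U) x) VUK.
rewrite (unitary_op_isometry _ _ _ VU) distrC -(unitary_op_isometry _ _ _ UV).
by rewrite (right_linearB _ Vl) -[V (U _)]/((V \o U) _) VUK.
Qed.

(** * Perturbation of an invertible operator, by the Banach fixed point theorem *)

Lemma contraction_fixpoint (k : R) (f : H -> H) : k < 1 -> 0 <= k ->
  (forall x y, `|f x - f y| <= k * `|x - y|) -> exists x, f x = x.
Proof.
move=> k1 k0 fk.
pose g : {fun [set: H] >-> [set: H]} := totalfun f.
have ctr : is_contraction g.
  by exists (NngNum k0); split=> //= -[x y] _; exact: fk.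
have [x _ xE] := banach_fixed_point ctr closedT (ex_intro _ 0 I).
by exists x; rewrite {2}xE.
Qed.

(** Since [A] inverts [B], [x - A (D x) = A (B x - D x)], so [A \o D] differs from the identity by a
    contraction of ratio [M * c]. This bounds [D] below, which gives injectivity and a bounded
    inverse, and makes [D x = y] a fixed point problem. *)
Lemma invertible_op_perturb A B D (M c : R) :
  right_linear A -> right_linear D -> cancel B A -> cancel A B ->
  0 < M -> 0 <= c -> M * c < 1 ->
  (forall x, `|A x| <= M * `|x|) -> (forall x, `|B x - D x| <= c * `|x|) ->
  invertible_op D.
Proof.
move=> Al Dl BK AK M0 c0 Mc1 AM BD.
have ABD x : `|x - A (D x)| <= M * c * `|x|.
  rewrite -{1}(BK x) -(right_linearB _ Al) -mulrA; apply: le_trans (AM _) _.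
  by rewrite ler_pM2l.
(* From [|x| <= |x - A (D x)| + |A (D x)|]. *)
have Dlow x : (1 - M * c) * `|x| <= M * `|D x|.
  rewrite mulrBl mul1r lerBlDl; have := ABD x; have := AM (D x).
  have := ler_distD (A (D x)) x 0; rewrite !subr0; lra.
have D_inj x y : D x = D y -> x = y.
  move=> Dxy; apply/eqP; rewrite -subr_eq0 -normr_le0.
  have := Dlow (x - y); rewrite (right_linearB _ Dl) Dxy subrr normr0 mulr0.
  by rewrite pmulr_rle0// subr_gt0.
have D_surj y : exists x, D x = y.
  (* A fixed point of this map satisfies [A (y - D x) = 0], and [A] is injective. *)
  have [|x z|x] := contraction_fixpoint (M * c) (fun x => x + A (y - D x)) Mc1.
  - by rewrite mulr_ge0// ltW.
  - rewrite (_ : _ - _ = (x - z) - A (D (x - z))) ?ABD//.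
    rewrite (right_linearB _ Dl) !(right_linearB _ Al) opprD addrACA; congr (_ + _).
    by rewrite !opprB addrC addrA subrK.
  - move=> xE; exists x; apply/eqP; rewrite eq_sym -subr_eq0; apply/eqP.
    apply: (can_inj AK); apply: (addrI x); rewrite xE.
    by rewrite -(subrr 0) (right_linearB _ Al) subrr addr0.
(* Preimages are chosen one by one; injectivity of [D] then makes the choice linear. *)
pose C y := projT1 (cid (D_surj y)).
have CK y : D (C y) = y := projT2 (cid (D_surj y)).
exists C; split; [split|..].
- split=> [x y|x q]; apply: D_inj.
  + by rewrite (proj1 Dl) !CK.
  + by rewrite (proj2 Dl) !CK.
- exists (M / (1 - M * c)) => y; rewrite mulrAC ler_pdivlMr ?subr_gt0//.
  by rewrite mulrC -{2}(CK y) Dlow.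
- by apply/funext => x /=; apply: D_inj; rewrite CK.
- by apply/funext => y /=; rewrite CK.
Qed.

(** * The inclusions for the S-spectrum and the numerical range *)

Lemma unitarily_close_spectrum T S : bounded_op T -> bounded_op S ->
  unitarily_close T S -> S_spectrum T `<=` S_spectrum S.
Proof.
move=> bT bS TS q; apply: contra_not => -[A [bA AS SA]].
have [K K0 TK] := bounded_op_norm T bT.
have [L L0 SL] := bounded_op_norm S bS.
have [M M0 AM] := bounded_op_norm A bA.
(* With [X = U \o S \o V] within [e] of [T], [Delta q X] is within [a * e] of [Delta q T]; taking
   [e = (2 * M * a)^-1] gives [M * (a * e) = 1/2]. *)
pose a := K + L + `|2 * qre q|.
have a0 : 0 < a by rewrite ltr_wpDr ?addr_gt0.
have Ma0 : 0 < 2 * M * a by rewrite !mulr_gt0.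
have e0 : 0 < (2 * M * a)^-1 by rewrite invr_gt0.
have [U [V [UV UVe]]] := TS _ e0.
set e := (2 * M * a)^-1 in e0 UVe.
have Uiso x := unitary_op_isometry _ _ x (unitary_op_sym _ _ UV).
have Viso x := unitary_op_isometry _ _ x UV.
have [[Ul _] [[Vl _] _] /funeqP VUK /funeqP UVK] := UV.
have VU x : V (U x) = x := VUK x.
have UVid x : U (V x) = x := UVK x.
move/funeqP in AS; move/funeqP in SA.
have {}AS x : A (Delta q S x) = x := AS x.
have {}SA x : Delta q S (A x) = x := SA x.
have [[Tl _] [[Al _] [Sl _]]] := (bT, (bA, bS)).
pose X := U \o S \o V.
have Xe x : `|X x - T x| <= e * `|x| := UVe x.
have BE x : U (Delta q S (V x)) = Delta q X x.
  by rewrite /Delta (proj1 Ul) (right_linearB _ Ul) !(right_linearZ _ Ul) /X /= VU UVid.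
have XL x : `|X x| <= L * `|x| by rewrite /X /= Uiso -(Viso x).
(* Conjugating [A] gives an inverse of [Delta q X], still bounded by [M] because [U] and [V] are
   isometries. *)
apply: (invertible_op_perturb (U \o A \o V) (U \o Delta q S \o V) _ M (a * e)).
- exact: right_linear_comp _ _ (right_linear_comp _ _ Ul Al) Vl.
- exact: right_linear_Delta.
- by move=> x /=; rewrite VU AS UVid.
- by move=> x /=; rewrite VU SA UVid.
- by [].
- by rewrite mulr_ge0 ?ltW.
- have -> : M * (a * e) = 2^-1 by rewrite /e; field; rewrite !gt_eqF.
  lra.
- by move=> x /=; rewrite Uiso -(Viso x).
move=> x; rewrite [X in `|X - _|]BE.
(* [X^2 - T^2 = (X - T) X + T (X - T)], and the [|q|^2] terms cancel. *)
have -> : Delta q X x - Delta q T x =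
    (X (X x) - T (X x)) + T (X x - T x) - (2 * qre q) *: (X x - T x).
  rewrite /Delta (right_linearB _ Tl) scalerBr addrA subrK.
  by rewrite opprD addrACA subrr addr0 !opprD addrACA.
apply: le_trans (ler_normB _ _) _; rewrite normrZ.
have h1 := ler_normD (X (X x) - T (X x)) (T (X x - T x)).
have h2 := Xe (X x).
have h3 := TK (X x - T x).
have h4 : e * `|X x| <= e * (L * `|x|) by rewrite ler_pM2l.
have h5 : K * `|X x - T x| <= K * (e * `|x|) by rewrite ler_pM2l.
have h6 : `|2 * qre q| * `|X x - T x| <= `|2 * qre q| * (e * `|x|) by rewrite ler_wpM2l.
rewrite /a; lra.
Qed.

(** For a unit vector [x], [V x] is a unit vector and [<S (V x), V x> = <U (S (V x)), x>], which is
    close to [<T x, x>] by Cauchy-Schwarz. *)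
Lemma unitarily_close_numerical_range T S : unitarily_close T S ->
  closure (numerical_range T) `<=` closure (numerical_range S).
Proof.
move=> TS; rewrite [X in _ `<=` X](closure_id _).1; last exact: closed_closure.
apply: closure_subset => _ [x /= x1 <-] B /nbhs_ballP[e /= e0 eB].
(* Halving [e] turns the weak estimate into the strict inequality of the open ball. *)
have [U [V [UV UVe]]] := TS (e / 2) (divr_gt0 e0 (ltr0Sn _ 1)).
exists (qdot (S (V x)) (V x)); split.
  by exists (V x) => //=; rewrite (unitary_op_isometry _ _ _ UV).
apply: eB; rewrite -ball_normE /=.
have [_ [_ UVadj] _ _] := UV.
rewrite -UVadj -qdotNl -qdotDl.
apply: le_lt_trans (qdot_le_norm _ _ x1) _; rewrite distrC.
by apply: le_lt_trans (UVe x) _; rewrite x1 mulr1 ltr_pdivrMr// ltr_pMr// ltr1n.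
Qed.

End QuatHilbertTheory.

Theorem proposition2p3 (R : realType) (H : quatHilbertType R)
  (sepH : separable H) (T S : H -> H)
  (bT : bounded_op T) (bS : bounded_op S)
  (TS : approx_unitary_equiv T S) :
  S_spectrum T = S_spectrum S /\
  closure (numerical_range T) = closure (numerical_range S).
Proof.
have clTS := approx_unitary_equiv_close _ _ bT bS TS.
have clST := unitarily_close_sym _ _ clTS.
split; apply/seteqP; split.
- exact: unitarily_close_spectrum.
- exact: unitarily_close_spectrum.
- exact: unitarily_close_numerical_range.
- exact: unitarily_close_numerical_range.
Qed.
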